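(* Let $A$ be a boundedly invertible, not necessarily bounded, operator with domain $D(A)\subset H$, where $H$ is a complex Hilbert space. If $A^p$ and $A^q$ are normal, where $p$ and $q$ are two co-prime positive integers, then $A$ is normal.
   Context: Operators are linear and not necessarily bounded. Powers are defined on natural domains, with $D(ST)=\{x\in D(T):Tx\in D(S)\}$. $A$ is boundedly invertible if there is an everywhere defined $B\in B(H)$ such that $AB=I$ and $BA\subset I$. A densely defined operator $S$ is normal if it is closed and $SS^*=S^*S$ (equality including domains). *)

(* Defs.v *)
(* Built on Mathematical Components and MathComp-Analysis. *)
From mathcomp Require Import all_boot all_order all_algebra.
From mathcomp Require Import complex.
From mathcomp Require Import all_classical all_reals all_analysis.

Set Implicit Arguments.
Unset Strict Implicit.
Unset Printing Implicit Defensive.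

Import Order.TTheory GRing.Theory Num.Theory.
Import numFieldNormedType.Exports.

Local Open Scope classical_set_scope.
Local Open Scope ring_scope.
Local Open Scope complex_scope.

(* A complete normed space over [R[i]] is a complex Hilbert space once its norm
   comes from an inner product.  A [{dot H for Num.conj}] is positive definite and
   hermitian, linear in its first and conjugate-linear in its second argument. *)
Definition induces_norm (R : realType) (H : completeNormedModType R[i])
    (ip : {dot H for @Num.conj R[i]}) : Prop :=
  forall x : H, ip x x = `|x| ^+ 2.

(* The values of [op_fun] outside [dom] are irrelevant: operators are only
   compared through [op_incl] and [op_eq]. *)
Record partial_op (R : realType) (H : completeNormedModType R[i]) :=
  PartialOp { dom : set H ; op_fun :> H -> H }.

Section Operators.
Context {R : realType} {H : completeNormedModType R[i]}.
Implicit Types S T A : partial_op H.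

Definition linear_op T : Prop :=
  dom T 0 /\
  forall (a : R[i]) (x y : H), dom T x -> dom T y ->
    dom T (a *: x + y) /\ T (a *: x + y) = a *: T x + T y.

Definition op_incl S T : Prop :=
  forall x, dom S x -> dom T x /\ S x = T x.

Definition op_eq S T : Prop := op_incl S T /\ op_incl T S.

Definition total_op (f : H -> H) : partial_op H := PartialOp setT f.

Definition op_id : partial_op H := total_op id.

Definition op_comp S T : partial_op H :=
  PartialOp [set x | dom T x /\ dom S (T x)] (S \o T).

Definition op_pow T (n : nat) : partial_op H := iter n (op_comp T) op_id.

Definition bounded_linear (B : {linear H -> H}) : Prop :=
  exists M : R[i], forall x : H, `|B x| <= M * `|x|.

Definition boundedly_invertible A : Prop :=
  exists B : {linear H -> H},
    [/\ bounded_linear B,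
        op_eq (op_comp A (total_op B)) op_id
      & op_incl (op_comp (total_op B) A) op_id].

Definition densely_defined T : Prop := dense (dom T).

Definition closed_op T : Prop :=
  closed [set u : H * H | dom T u.1 /\ u.2 = T u.1].

Definition adjoint_rel (ip : {dot H for @Num.conj R[i]}) T (y z : H) : Prop :=
  forall x, dom T x -> ip (T x) y = ip x z.

(* When [T] is densely defined the [z] chosen by [xget] is unique. *)
Definition adjoint (ip : {dot H for @Num.conj R[i]}) T : partial_op H :=
  PartialOp [set y | exists z, adjoint_rel ip T y z]
            (fun y => xget 0 [set z | adjoint_rel ip T y z]).

Definition normal_op (ip : {dot H for @Num.conj R[i]}) T : Prop :=
  [/\ densely_defined T, closed_op T
    & op_eq (op_comp T (adjoint ip T)) (op_comp (adjoint ip T) T)].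

End Operators.

(* Main.v *)
(* Let [B] be the bounded inverse of [A]. The inverse of a bounded injective [C]
   with adjoint [C'] is normal iff [C C' = C' C] (the Riesz representation theorem
   provides adjoints), so [B^p] and [B^q] are normal and [B] must be shown normal.
   Choose consecutive multiples [a = b + 1] of [p] and [q], and let
   [X = B'^a B^a] and [Y = B'^b B^b]. As [B^a] and [B^b] are normal,
   [P = Y^a = X^b] commutes with [B^a] and [B^b], hence with [B], since
   [B^b B = B^a] and [B^b] is injective. As [Y] is the positive [a]-th root of
   [P], [B] commutes with [Y], and then
   [Y B' B = B' Y B = B'^a B^a = B^a B'^a = B Y B' = Y B B'],
   where [Y] is injective. *)
Require Import Defs.
From mathcomp Require Import all_boot all_order all_algebra.
From mathcomp Require Import cyclic separable cyclotomic.
From mathcomp Require Import complex.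
From mathcomp Require Import all_classical all_reals all_analysis.
From mathcomp Require Import ring.

Set Implicit Arguments.
Unset Strict Implicit.
Unset Printing Implicit Defensive.

Import Order.TTheory GRing.Theory Num.Theory.
Import numFieldNormedType.Exports.

Local Open Scope complex_scope.
Local Open Scope classical_set_scope.
Local Open Scope ring_scope.

(** * Elementary inequalities for the inner product *)

Section InnerProduct.
Context {R : realType} {H : completeNormedModType R[i]}.
Context {ip : {dot H for @Num.conj R[i]}}.
Local Notation "''[' u , v ]" := (ip u v).
Local Notation "''[' u ]" := (ip u u).

Lemma ipC (x y : H) : '[x, y] = ('[y, x])^*.
Proof. by rewrite (hermC ip x y) expr0 mul1r. Qed.

Lemma ipZl a (x y : H) : '[a *: x, y] = a * '[x, y].
Proof. exact: linearZl_LR. Qed.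

Lemma ipZr a (x y : H) : '[x, a *: y] = a^* * '[x, y].
Proof. exact: linearZr_LR. Qed.

Lemma ip_injl (x y : H) : (forall z, '[x, z] = '[y, z]) -> x = y.
Proof.
move=> xy; apply/eqP; rewrite -subr_eq0 -(dnorm_eq0 ip) linearBl /=.
by rewrite xy subrr.
Qed.

Lemma ip_injr (x y : H) : (forall z, '[z, x] = '[z, y]) -> x = y.
Proof. by move=> xy; apply: ip_injl => z; rewrite ipC xy -ipC. Qed.

(* Minimality is tested at [c = '[w, z] / (1 + '[z])]: adding 1 to the optimal
   denominator avoids treating [z = 0] apart. *)
Lemma almost_min_ortho (w z : H) (e : R[i]) :
    (forall c, '[w] <= '[w - c *: z] + e) ->
  `|'[w, z]| ^+ 2 <= e * (1 + '[z]).
Proof.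
move=> min_w; set n := '[z]; set a := '[w, z].
have n0 : 0 <= n by exact: dnorm_ge0.
have n1 : 0 < 1 + n by rewrite ltr_pwDl.
have n1u : 1 + n != 0 by rewrite gt_eqF.
have tR : ((1 + n)^-1)^* = (1 + n)^-1.
  by apply/CrealP; rewrite realV realD ?real1 ?ger0_real.
have := min_w ((1 + n)^-1 * a).
rewrite dnormB /= dnormZ ipZr -/a -/n.
have -> : ((1 + n)^-1 * a)^* * a = (1 + n)^-1 * `|a| ^+ 2.
  by rewrite rmorphM /= tR -mulrA [a^* * a]mulrC -normCK.
have -> : ((1 + n)^-1 * `|a| ^+ 2)^* = (1 + n)^-1 * `|a| ^+ 2.
  by rewrite rmorphM /= tR rmorphXn /= conj_normC.
rewrite normrM exprMn (ger0_norm (ltW _)) ?invr_gt0//.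
have a0 : 0 <= `|a| ^+ 2 by rewrite exprn_ge0.
rewrite -addrA -addrA lerDl => le_e.
rewrite -ler_pdivrMr//.
rewrite -subr_ge0; apply: le_trans le_e _.
rewrite -subr_ge0.
have -> : e - `|a| ^+ 2 / (1 + n) -
    ((1 + n)^-1 ^+ 2 * `|a| ^+ 2 * n
      + (- ((1 + n)^-1 * `|a| ^+ 2 + (1 + n)^-1 * `|a| ^+ 2) + e))
    = `|a| ^+ 2 * ((1 + n)^-1) ^+ 2.
  by field.
by rewrite mulr_ge0// exprn_ge0// invr_ge0 ltW.
Qed.

(** A weak form of Cauchy-Schwarz: with error ['[x]] itself, the minimality hypothesis of
    [almost_min_ortho] is trivially met. *)
Lemma ip_bound (x y : H) : `|'[x, y]| ^+ 2 <= '[x] * (1 + '[y]).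
Proof. by apply: almost_min_ortho => c; rewrite lerDr dnorm_ge0. Qed.

End InnerProduct.

(** * Orthogonal projection and Riesz representation *)

Section Hilbert.
Context {R : realType} {H : completeNormedModType R[i]}.
Context {ip : {dot H for @Num.conj R[i]}} (hH : induces_norm ip).
Local Notation "''[' u , v ]" := (ip u v).
Local Notation "''[' u ]" := (ip u u).

Lemma ge0_RRe (c : R[i]) : 0 <= c -> c = (complex.Re c)%:C.
Proof. by move=> c0; rewrite RRe_real// ger0_real. Qed.

Lemma parallelogram (x y : H) : '[x + y] + '[x - y] = 2 * '[x] + 2 * '[y].
Proof. by rewrite dnormD dnormB /=; ring. Qed.

Lemma ip_small (x z : H) (e : R[i]) :
  0 <= e -> `|x| <= e / (1 + '[z]) -> `|'[x, z]| <= e.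
Proof.
move=> e0 xe; have z1 : 0 < 1 + '[z] by rewrite ltr_pwDl// dnorm_ge0.
have d0 := le_trans (normr_ge0 x) xe.
rewrite -(@ler_pXn2r _ 2)// ?nnegrE//.
apply: le_trans (ip_bound _ _) _; rewrite hH.
apply: (@le_trans _ _ ((e / (1 + '[z])) ^+ 2 * (1 + '[z]) ^+ 2)).
  apply: ler_pM; rewrite ?exprn_ge0 ?(ltW z1)//.
    by rewrite ler_pXn2r ?nnegrE.
  by rewrite expr2 ler_peMr ?(ltW z1)// lerDl dnorm_ge0.
by rewrite -exprMn divfK ?gt_eqF.
Qed.

(** The subspace may fail to be closed, so [u] is only a limit of its points. It is the limit of
    near-minimisers of the distance to [x], and [almost_min_ortho] passes to this limit. *)
Lemma exists_projection (V : set H) (x : H) : V 0 ->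
    (forall a u v, V u -> V v -> V (a *: u + v)) ->
  exists2 u, (forall e, 0 < e -> exists2 v, V v & `|u - v| < e) &
             forall z, V z -> '[x - u, z] = 0.
Proof.
move=> V0 Vlin.
(* The infimum is taken in the real field [R], hence the real parts; squared norms are nonnegative,
   so nothing is lost. *)
pose E := [set complex.Re '[x - v] | v in V].
have Elb : has_inf E.
  split; first by exists (complex.Re '[x - 0]); exists 0.
  exists 0 => _ [v _ <-].
  by rewrite -lecR -ge0_RRe ?dnorm_ge0.
pose D := inf E.
have leD v : V v -> D%:C <= '[x - v].
  move=> Vv; rewrite (ge0_RRe (dnorm_ge0 ip (x - v))) lecR.
  by apply: ge_inf; [case: Elb | exists v].
pose S (e : R[i]) := [set v | V v /\ '[x - v] < D%:C + e].
have S0 e : 0 < e -> S e !=set0.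
  move=> e0; have eE := ge0_RRe (ltW e0).
  have e0' : 0 < complex.Re e by rewrite -ltcR -eE.
  have [_ [v Vv <-] lte] := inf_adherent e0' Elb.
  exists v; split => //.
  by rewrite eE (ge0_RRe (dnorm_ge0 ip (x - v))) -rmorphD ltcR.
(* Parallelogram law for [x - v] and [x - v']: the midpoint of [v] and [v'] lies in [V], so its
   squared distance to [x] is at least [D]. *)
have Sdist e v v' : S e v -> S e v' -> '[v - v'] <= 4 * e.
  move=> [Vv /ltW le1] [Vv' /ltW le2].
  have Vm : V (2^-1 *: (v + v')).
    have := Vlin 2^-1 (1 *: v + v') 0.
    by rewrite scale1r addr0; apply => //; rewrite -[v]scale1r; exact: Vlin.
  have := leD _ Vm; have := parallelogram (x - v) (x - v').
  have -> : x - v + (x - v') = 2 *: (x - 2^-1 *: (v + v')).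
    rewrite scalerBr scalerA divff ?pnatr_eq0// scale1r scaler_nat.
    by rewrite mulr2n opprD addrACA.
  have -> : x - v - (x - v') = - (v - v').
    by rewrite !opprB addrC addrA subrK.
  rewrite hnormN dnormZ ger0_norm ?ler0n// => par le3.
  rewrite -(lerD2l (2 ^+ 2 * '[x - 2^-1 *: (v + v')])) par.
  apply: le_trans (lerD (ler_wpM2l (ler0n _ 2) le1) (ler_wpM2l (ler0n _ 2) le2)) _.
  rewrite -subr_ge0.
  rewrite (_ : _ - _ = 4 * ('[x - 2^-1 *: (v + v')] - D%:C)); last by ring.
  by rewrite mulr_ge0// subr_ge0.
(* This filter plays the role of a minimising sequence. *)
pose F := filter_from [set e : R[i] | 0 < e] S.
have FF : Filter F.
  apply: filter_from_filter; first by exists 1 => /=; exact: ltr01.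
  move=> e1 e2 /= e10 e20.
  (* The order of [R[i]] is partial; this positive value lies below both [e1] and [e2] and stands in
     for their minimum. *)
  exists (e1 * e2 / (e1 + e2)) => /=.
    by rewrite divr_gt0 ?mulr_gt0 ?addr_gt0.
  move=> v [Vv lev]; split; split => //; apply: lt_le_trans lev _;
    rewrite lerD2l ler_pdivrMr ?addr_gt0// mulrDr.
  - by rewrite lerDr mulr_ge0// ltW.
  - by rewrite [e2 * e1]mulrC lerDl mulr_ge0// ltW.
have PF : ProperFilter F by apply: filter_from_proper.
have SF e : 0 < e -> F (S e) by move=> e0; exists e.
have cF : cvg F.
  apply: cauchy_cvg; apply: cauchy_exP => e e0.
  (* By [Sdist] the squared distances are then at most [4 * (e / 3) ^+ 2], which is below
     [e ^+ 2]. *)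
  have e4 : 0 < (e / 3) ^+ 2 by rewrite exprn_gt0// divr_gt0.
  have [v Sv] := S0 _ e4; exists v; exists ((e / 3) ^+ 2) => // v' Sv'.
  rewrite -ball_normE /=; have := Sdist _ _ _ Sv Sv'; rewrite hH => lev.
  rewrite -(@ltr_pXn2r _ 2)// ?nnegrE ?(ltW e0)//.
  apply: le_lt_trans lev _.
  rewrite -subr_gt0 (_ : _ - _ = (5 / 9) * e ^+ 2); last by field.
  by rewrite mulr_gt0 ?exprn_gt0// divr_gt0.
pose u := lim F.
have uV e e' : 0 < e -> 0 < e' -> exists2 v, S e v & `|u - v| < e'.
  move=> e0 e'0.
  have : F (S e `&` ball u e').
    apply: filterI; first exact: SF.
    exact: (cF _ (nbhsx_ballx u e' e'0)).
  by move=> /filter_ex[v [Sv]]; rewrite -ball_normE /=; exists v.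
exists u.
  by move=> e e0; have [v [Vv _] le] := uV 1 e ltr01 e0; exists v.
move=> z Vz.
have ortho e v : S e v -> `|'[x - v, z]| ^+ 2 <= e * (1 + '[z]).
  move=> [Vv lev]; apply: almost_min_ortho => c.
  apply: le_trans (ltW lev) _; rewrite lerD2r.
  have -> : x - v - c *: z = x - (c *: z + v) by rewrite opprD addrA addrAC.
  exact/leD/Vlin.
have n1 : 0 < 1 + '[z] by rewrite ltr_pwDl// dnorm_ge0.
have sm e : 0 < e -> `|'[x - u, z]| <= 2 * e.
  (* [k] turns the bound of [ortho] into [e ^+ 2], and [k'] is the radius asked by [ip_small]; each
     contributes one [e]. *)
  move=> e0; pose k := e ^+ 2 / (1 + '[z]).
  have k0 : 0 < k by rewrite divr_gt0// exprn_gt0.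
  pose k' := e / (1 + '[z]).
  have k'0 : 0 < k' by rewrite divr_gt0.
  have [v Sv luv] := uV k k' k0 k'0.
  have -> : x - u = x - v - (u - v) by rewrite opprB addrA subrK.
  rewrite linearBl /=; apply: le_trans (ler_normB _ _) _.
  rewrite mulr_natl mulr2n; apply: lerD.
    rewrite -(@ler_pXn2r _ 2)// ?nnegrE ?(ltW e0)//.
    by apply: le_trans (ortho _ _ Sv) _; rewrite /k divfK ?gt_eqF.
  exact: ip_small (ltW e0) (ltW luv).
apply/eqP; rewrite -normr_le0; apply/ler_addgt0Pr => e e0; rewrite add0r.
have e20 : 0 < e / 2 by rewrite divr_gt0.
by apply: le_trans (sm _ e20) _; rewrite mulrC divfK ?pnatr_eq0.
Qed.

Lemma ortho_dense (V : set H) : V 0 ->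
    (forall a u v, V u -> V v -> V (a *: u + v)) ->
    (forall w, (forall z, V z -> '[w, z] = 0) -> w = 0) -> dense V.
Proof.
move=> V0 Vlin Vperp O [x Ox] oO.
have [u uV /Vperp/subr0_eq xu] := exists_projection x V0 Vlin.
rewrite {x}xu in Ox.
have /nbhs_ballP[e /= e0 eO] : nbhs u O by apply: open_nbhs_nbhs; split.
have [v Vv uv] := uV e e0.
by exists v; split => //; apply: eO; rewrite -ball_normE.
Qed.

(** A vector outside the kernel of [f], minus its projection on the kernel, spans the orthogonal
    complement of the kernel. *)
Lemma riesz (f : H -> R[i]) (M : R[i]) :
    (forall a x y, f (a *: x + y) = a * f x + f y) ->
    (forall x, `|f x| <= M * `|x|) ->
  exists y, forall x, f x = '[x, y].
Proof.
move=> flin fM.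
have f0 : f 0 = 0.
  by apply/eqP; rewrite -normr_le0 (le_trans (fM 0))// normr0 mulr0.
have fB x y : f (x - y) = f x - f y.
  by rewrite addrC -scaleN1r flin mulN1r addrC.
have [fz|/existsNP[x0 /eqP fx0]] := pselect (forall x, f x = 0).
  by exists 0 => x; rewrite fz linear0r.
have [||u uV uortho] := @exists_projection [set v | f v = 0] x0.
- exact: f0.
- by move=> a v w /= fv fw; rewrite flin fv fw mulr0 addr0.
(* [u] is a limit of points of the kernel and [f] is continuous. The sign of [M] is not given, hence
   the positive bound [1 + |M|]. *)
have fu : f u = 0.
  apply/eqP; rewrite -normr_le0; apply/ler_addgt0Pr => e e0; rewrite add0r.
  have M0 : 0 < 1 + `|M| by rewrite ltr_pwDl.
  have eM : 0 < e / (1 + `|M|) by rewrite divr_gt0.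
  have [v /= fv uv] := uV _ eM.
  rewrite -[f u]subr0 -fv -fB; apply: le_trans (fM _) _.
  have M1 : M * `|u - v| <= (1 + `|M|) * `|u - v|.
    have g0 := le_trans (normr_ge0 _) (fM (u - v)).
    by rewrite -(ger0_norm g0) normrM normr_id ler_wpM2r// lerDr.
  apply: le_trans M1 _; rewrite mulrC -ler_pdivlMr//; exact: ltW.
pose w := x0 - u.
have fw : f w != 0 by rewrite fB fu subr0.
have w0 : '[w] != 0.
  by rewrite dnorm_eq0; apply: contraNneq fw => ->; rewrite f0.
(* The vector [x - (f x / f w) w] lies in the kernel, so it is orthogonal to [w]; solving for [f x]
   gives this multiple, conjugated because it sits in the second argument. *)
exists ((f w / '[w])^* *: w) => x; rewrite ipZr conjCK.
have : '[w, x - (f x / f w) *: w] = 0.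
  apply: uortho => /=; rewrite addrC -scaleNr flin mulNr.
  by rewrite divfK// addNr.
rewrite linearBr /= ipZr => /subr0_eq e1.
rewrite (ipC x w) e1 rmorphM /= conjCK -ipC.
by field; rewrite fw w0.
Qed.

End Hilbert.

(** * Primitive roots of unity *)

Lemma exists_prim_root (C : closedFieldType) (n : nat) :
  n%:R != 0 :> C -> exists z : C, n.-primitive_root z.
Proof.
move=> nC; have n0 : (0 < n)%N by case: n nC => //; rewrite eqxx.
have [r rE] := closed_field_poly_normal ('X^n - 1 : {poly C}).
rewrite (monicP (monicXnsubC 1 n0)) scale1r in rE.
suff /hasP[z _ zP] : has n.-primitive_root r by exists z.
apply: has_prim_root => //.
- by apply/allP => z; rewrite -root_prod_XsubC -rE.
- by rewrite -separable_prod_XsubC -rE separable_Xn_sub_1.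
- by rewrite -ltnS -(size_prod_XsubC r id) -rE size_XnsubC.
Qed.

(** Orthogonality of the characters of a cyclic group, by summing a geometric progression of ratio
    [z ^+ k / z ^+ i]. *)
Lemma prim_root_sum (F : fieldType) (n i k : nat) (z : F) :
    n.-primitive_root z -> (i < n)%N -> (k < n)%N ->
  \sum_(j < n) z ^+ (j * k) / z ^+ (j * i) = if k == i then n%:R else 0.
Proof.
move=> zP ltin ltkn.
have z0 : z != 0 by rewrite (prim_root_eq0 zP) -lt0n (prim_order_gt0 zP).
under eq_bigr => j _ do
  rewrite [(j * k)%N]mulnC [(j * i)%N]mulnC !exprM -exprVn -exprMn.
case: eqP => [->|/eqP neq].
  rewrite divff ?expf_neq0//.
  by under eq_bigr => j _ do rewrite expr1n; rewrite sumr_const card_ord.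
apply: (@mulfI _ (z ^+ k / z ^+ i - 1)).
  rewrite subr_eq0; apply: contraNneq neq => e.
  rewrite -(modn_small ltin) -(modn_small ltkn) -(eq_prim_root_expr zP).
  by rewrite -[z ^+ k](divfK (expf_neq0 i z0)) e mul1r.
rewrite mulr0 -subrX1 exprMn exprVn -!exprM ![(_ * n)%N]mulnC !exprM.
by rewrite (prim_expr_order zP) !expr1n invr1 mul1r subrr.
Qed.

(** * Adjoint pairs, bounded maps and intertwiners *)

Section Operators.
Context {R : realType} {H : completeNormedModType R[i]}.
Context {ip : {dot H for @Num.conj R[i]}} (hH : induces_norm ip).
Local Notation "''[' u , v ]" := (ip u v).
Local Notation "''[' u ]" := (ip u u).

(** Bare functions instead of linear maps: having an adjoint already forces linearity, and
    composites and iterates stay plain terms. *)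
Definition adjoint_pair (f g : H -> H) := forall x y, '[f x, y] = '[x, g y].

Definition op_bounded (f : H -> H) :=
  exists2 M : R[i], 0 <= M & forall x, `|f x| <= M * `|x|.

Lemma adjoint_pairC f g : adjoint_pair f g -> adjoint_pair g f.
Proof. by move=> fg x y; rewrite ipC -fg -ipC. Qed.

Lemma adjoint_pair_comp f f' g g' :
  adjoint_pair f f' -> adjoint_pair g g' -> adjoint_pair (f \o g) (g' \o f').
Proof. by move=> fP gP x y /=; rewrite fP gP. Qed.

Lemma adjoint_pair_iter f g n :
  adjoint_pair f g -> adjoint_pair (iter n f) (iter n g).
Proof.
by move=> fg; elim: n => [//|n IHn] x y; rewrite iterS fg IHn -iterSr.
Qed.

Lemma adjoint_pair_linear f g : adjoint_pair f g -> linear f.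
Proof.
move=> fg a x y; apply: (ip_injl (ip := ip)) => z.
by rewrite fg !linearDl /= !ipZl !fg.
Qed.

Lemma adjoint_pair0 f g : adjoint_pair f g -> f 0 = 0.
Proof. by move=> fg; apply: (ip_injl (ip := ip)) => z; rewrite fg !linear0l. Qed.

Lemma adjoint_pairZ f g a x : adjoint_pair f g -> f (a *: x) = a *: f x.
Proof.
move=> fg; rewrite -[a *: x]addr0 (adjoint_pair_linear fg).
by rewrite (adjoint_pair0 fg) addr0.
Qed.

Lemma adjoint_pairD f g x y : adjoint_pair f g -> f (x + y) = f x + f y.
Proof.
by move=> fg; rewrite -[x]scale1r (adjoint_pair_linear fg) !scale1r.
Qed.

Lemma adjoint_pairB f g x y : adjoint_pair f g -> f (x - y) = f x - f y.
Proof.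
move=> fg; rewrite -scaleN1r (adjoint_pairD _ _ fg) (adjoint_pairZ _ _ fg).
by rewrite scaleN1r.
Qed.

Lemma adjoint_pair_injective f g : adjoint_pair f g ->
  (forall x, f x = 0 -> x = 0) -> injective f.
Proof.
move=> fg finj x y xy; apply/eqP; rewrite -subr_eq0; apply/eqP/finj.
by rewrite (adjoint_pairB _ _ fg) xy subrr.
Qed.

Lemma op_bounded_comp f g :
  op_bounded f -> op_bounded g -> op_bounded (f \o g).
Proof.
move=> [M M0 fM] [N N0 gN]; exists (M * N); first exact: mulr_ge0.
by move=> x; apply: le_trans (fM _) _; rewrite -mulrA ler_wpM2l.
Qed.

Lemma op_bounded_iter f n : op_bounded f -> op_bounded (iter n f).
Proof.
move=> fb; elim: n => [|n IHn]; last exact: op_bounded_comp fb IHn.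
by exists 1 => [|x]; rewrite ?ler01// mul1r.
Qed.

Lemma op_bounded_sum n (a : nat -> R[i]) (f : nat -> H -> H) :
    (forall k, op_bounded (f k)) ->
  op_bounded (fun x => \sum_(k < n) a k *: f k x).
Proof.
move=> fb; elim: n => [|n [M M0 IHn]].
  by exists 0 => // x; rewrite big_ord0 normr0 mul0r.
have [N N0 fN] := fb n.
exists (M + `|a n| * N) => [|x]; first by rewrite addr_ge0// mulr_ge0.
rewrite big_ord_recr /= mulrDl; apply: le_trans (ler_normD _ _) _.
by rewrite lerD// normrZ -mulrA ler_wpM2l.
Qed.

Lemma op_bounded_ip f : op_bounded f ->
  exists2 M : R[i], 0 <= M & forall x, '[f x] <= M * '[x].
Proof.
move=> [M M0 fM]; exists (M ^+ 2) => [|x]; first exact: exprn_ge0.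
by rewrite !hH -exprMn ler_pXn2r ?nnegrE ?mulr_ge0.
Qed.

(** Nonnegative elements of [R[i]] are real, which reduces the claim to the Archimedean property of
    [R]. *)
Lemma archimedean_eq0 (a K : R[i]) :
  0 <= a -> (forall k : nat, k%:R * a <= K) -> a = 0.
Proof.
move=> a0 aK; have K0 : 0 <= K by apply: le_trans (aK 0%N); rewrite mul0r.
apply: contraTeq isT => an0.
have aE := ge0_RRe a0; have KE := ge0_RRe K0.
have a1 : 0 < complex.Re a by rewrite -ltcR -aE lt_def an0.
have K1 : 0 <= complex.Re K by rewrite -lecR -KE.
have := archi_boundP (divr_ge0 K1 (ltW a1)); rewrite ltr_pdivrMr//.
rewrite ltNge -lecR rmorphM /= rmorph_nat -aE -KE => /negP[]; exact: aK.
Qed.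

(* Put [F = 1 + e (1 - w^* ) Y] and [G = 1 + e (w - 1) Y], so that [F C = C G].
   Then [G] is a contraction, whereas ['[F^k v]] grows linearly in [k] unless
   ['[Y v, v] = 0]; take [v = C x]. *)
Lemma intertwine_eq0 (Y C : H -> H) (w e : R[i]) :
    adjoint_pair Y Y -> (forall x, Y x = 0 -> x = 0) ->
    0 < e -> (forall x, e * '[Y x] <= '[Y x, x]) ->
    linear C -> op_bounded C -> `|w| = 1 -> w != 1 ->
    (forall x, Y (C x) = w *: C (Y x)) ->
  forall x, C x = 0.
Proof.
move=> YY Yinj e0 Ye Clin Cb w1 wn1 YC.
have ww : w * w^* = 1 by rewrite -normCK w1 expr1n.
have eR : e^* = e by apply/CrealP; rewrite ger0_real ?ltW.
pose s := (1 - w) * (1 - w^*).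
have s0 : 0 < s.
  have -> : s = `|1 - w| ^+ 2 by rewrite normCK rmorphB rmorph1.
  by rewrite exprn_gt0// normr_gt0 subr_eq0 eq_sym.
(* As [w] has modulus 1, [|1 - w|^2 = 2 - 2 Re w]. Hence [s] governs both the linear and the
   quadratic coefficient of [normDY], and [Ye] can compare the two terms. *)
have sE : s = (1 - w) + (1 - w^*).
  have -> : s = 1 - w - w^* + w * w^* by rewrite /s; ring.
  by rewrite ww; ring.
pose q x := '[Y x, x].
have q0 x : 0 <= q x.
  by apply: le_trans (Ye x); rewrite mulr_ge0 ?dnorm_ge0 ?(ltW e0).
have qR x : '[x, Y x] = q x by rewrite -YY.
pose c := e * (1 - w^*).
have cC : c^* = e * (1 - w).
  by rewrite /c rmorphM /= eR rmorphB rmorph1 /= conjCK.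
have cc : `|c| ^+ 2 = e ^+ 2 * s by rewrite normCK cC /c /s; ring.
have cD : c + c^* = e * s by rewrite cC /c sE; ring.
have es0 : 0 < e * s by rewrite mulr_gt0.
pose F x := x + c *: Y x.
pose G x := x + (- c^*) *: Y x.
have FC x : F (C x) = C (G x).
  rewrite /F /G YC addrC [RHS]/= [x + _]addrC Clin [LHS]addrC addrC scalerA.
  congr (_ *: _ + _); rewrite cC /c.
  have -> : e * (1 - w^*) * w = e * (w - w * w^*) by ring.
  by rewrite ww; ring.
have normDY a x : '[x + a *: Y x] = '[x] + `|a| ^+ 2 * '[Y x] + (a + a^*) * q x.
  rewrite dnormD /= dnormZ ipZr qR rmorphM /= conjCK.
  by rewrite (CrealP (ger0_real (q0 x))) -mulrDl [a^* + a]addrC.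
have Gle x : '[G x] <= '[x].
  rewrite normDY normrN norm_conjC cc rmorphN /= conjCK -opprD [c^* + c]addrC cD.
  rewrite -addrA gerDl.
  have -> : e ^+ 2 * s * '[Y x] + - (e * s) * q x = e * s * (e * '[Y x] - q x).
    by ring.
  by rewrite pmulr_rle0// subr_le0.
have Fge x : '[x] + e * s * q x <= '[F x].
  rewrite normDY cc cD -addrA lerD2l lerDr.
  exact: mulr_ge0 (mulr_ge0 (exprn_ge0 _ (ltW e0)) (ltW s0)) (dnorm_ge0 _ _).
(* Since [q] does not decrease along [F], every iteration adds at least [e * s * q v] to the squared
   norm. *)
have qF x : q x <= q (F x).
  rewrite /q.
  have -> : Y (F x) = Y x + c *: Y (Y x).
    by rewrite (adjoint_pairD _ _ YY) (adjoint_pairZ _ _ YY).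
  rewrite linearDl !linearDr /= !ipZl !ipZr (YY (Y x) x).
  have -> : '[Y x, x] + c^* * '[Y x] + (c * '[Y x] + c * (c^* * '[Y (Y x), Y x]))
    = q x + ((c + c^*) * '[Y x] + c * c^* * q (Y x)) by rewrite /q; ring.
  rewrite lerDl cD -normCK addr_ge0//.
    by rewrite mulr_ge0 ?(ltW es0) ?dnorm_ge0.
  by rewrite mulr_ge0 ?exprn_ge0.
have growth k v : '[v] + k%:R * (e * s * q v) <= '[iter k F v].
  elim: k v => [|k IHk] v; first by rewrite mul0r addr0.
  rewrite iterSr; apply: le_trans (IHk (F v)).
  rewrite -natr1 mulrDl mul1r addrA addrAC; apply: lerD (Fge v) _.
  by rewrite ler_wpM2l ?ler0n// ler_wpM2l ?(ltW es0).
have [M M0 CM] := op_bounded_ip Cb.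
move=> x; set v := C x.
have FCk k y : iter k F (C y) = C (iter k G y).
  by elim: k => //= k ->; rewrite FC.
have Gk k : '[iter k G x] <= '[x].
  by elim: k => //= k; apply: le_trans.
have bnd k : k%:R * (e * s * q v) <= M * '[x].
  apply: le_trans (_ : '[v] + k%:R * (e * s * q v) <= _).
    by rewrite lerDr dnorm_ge0.
  apply: le_trans (growth k v) _; rewrite FCk; apply: le_trans (CM _) _.
  by rewrite ler_wpM2l.
have /eqP := archimedean_eq0 (mulr_ge0 (ltW es0) (q0 v)) bnd.
rewrite mulf_eq0 gt_eqF//= => /eqP qv.
apply: Yinj; apply/eqP; rewrite -(dnorm_eq0 ip) eq_le dnorm_ge0 andbT.
by rewrite -(pmulr_rle0 _ e0) -qv.
Qed.

End Operators.

(** * Commuting functions and their iterates *)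

Definition fun_comm (T : Type) (f g : T -> T) := forall x, f (g x) = g (f x).

Lemma fun_comm_iter (T : Type) (f g : T -> T) n :
  fun_comm f g -> fun_comm f (iter n g).
Proof. by move=> fg; elim: n => //= n IHn x; rewrite fg IHn. Qed.

Lemma fun_comm_iter2 (T : Type) (f g : T -> T) m n :
  fun_comm f g -> fun_comm (iter m f) (iter n g).
Proof.
by move=> fg x; apply/esym/fun_comm_iter => y; apply/esym/fun_comm_iter.
Qed.

Lemma iter_mul (T : Type) (f : T -> T) m n x :
  iter m (iter n f) x = iter (m * n) f x.
Proof. by elim: m => //= m ->; rewrite mulSn iterD. Qed.

Lemma iter_comm_comp (T : Type) (f g : T -> T) n x :
  fun_comm f g -> iter n (g \o f) x = iter n g (iter n f x).
Proof.
move=> fg; elim: n => //= n ->; congr (g _); exact: fun_comm_iter.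
Qed.

(** * Commutation with positive roots, and coprime powers *)

Section Roots.
Context {R : realType} {H : completeNormedModType R[i]}.
Context {ip : {dot H for @Num.conj R[i]}} (hH : induces_norm ip).
Local Notation "''[' u , v ]" := (ip u v).
Local Notation "''[' u ]" := (ip u u).
Local Notation adjoint_pair := (@adjoint_pair R H ip).

(* With [w] a primitive [m]-th root of unity, [sum_k w^(j k) Y^k T Y^(m-1-k)]
   intertwines [Y] and [w^-j Y], so that it vanishes when [0 < j < m]. By
   Fourier inversion [Y^k T Y^(m-1-k)] does not depend on [k]. *)
Lemma commute_root (Y T : H -> H) (e : R[i]) (m : nat) :
    adjoint_pair Y Y -> (forall x, Y x = 0 -> x = 0) -> op_bounded Y ->
    0 < e -> (forall x, e * '[Y x] <= '[Y x, x]) ->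
    linear T -> op_bounded T -> (0 < m)%N -> fun_comm T (iter m Y) ->
  fun_comm T Y.
Proof.
(* For [m = 1] the hypothesis is the goal; from here on [m = n + 2]. *)
move=> YY Yinj Yb e0 Ye Tlin Tb; case: m => // -[//|n] _ TY.
have [w wP] : exists w : R[i], n.+2.-primitive_root w.
  by apply: exists_prim_root; rewrite pnatr_eq0.
pose U k x := iter k Y (T (iter (n.+1 - k) Y x)).
pose S j x := \sum_(k < n.+2) w ^+ (j * k) *: U k x.
have w0 : w != 0 by rewrite (prim_root_eq0 wP).
have Ylin k : linear (iter k Y) := adjoint_pair_linear (adjoint_pair_iter k YY).
have Ulin k : linear (U k) by move=> a x y; rewrite /U !(Ylin, Tlin).
have Slin j : linear (S j).
  move=> a x y; rewrite /S scaler_sumr -big_split /=; apply: eq_bigr => k _.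
  by rewrite Ulin scalerDr !scalerA mulrC.
have Sb j : op_bounded (S j).
  apply: (op_bounded_sum n.+2 (fun k => w ^+ (j * k))) => k.
  by apply: op_bounded_comp (op_bounded_comp Tb _); exact: op_bounded_iter.
(* Up to the factor [w ^+ j], [Y] shifts the summands of [S j] by one index; the last wraps around
   to the first because [w ^+ m = 1] and [T] commutes with [Y^m]. *)
have YS j x : Y (S j x) = w ^- j *: S j (Y x).
  apply: (canRL (scalerK _)); rewrite ?expf_neq0//.
  pose V k := w ^+ (j * k) *: iter k Y (T (iter (n.+2 - k) Y x)).
  have -> : S j (Y x) = \sum_(k < n.+2) V k.
    apply: eq_bigr => -[k /= ltk] _; rewrite /V /U -iterSr -subSn//.
  have Ysum (s : seq nat) f : Y (\sum_(k <- s) f k) = \sum_(k <- s) Y (f k).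
    elim: s => [|k s IHs]; first by rewrite !big_nil (adjoint_pair0 YY).
    by rewrite !big_cons (adjoint_pairD _ _ YY) IHs.
  have -> : w ^+ j *: Y (S j x) = \sum_(k < n.+2) V k.+1.
    rewrite /S -(big_mkord xpredT (fun k => w ^+ (j * k) *: U k x)) Ysum.
    rewrite big_mkord scaler_sumr; apply: eq_bigr => -[k /= ltk] _.
    rewrite (adjoint_pairZ _ _ YY) scalerA -exprD -mulnS.
    by rewrite /V /U subSS.
  have VE : V n.+2 = V 0%N.
    rewrite /V muln0 [(j * _)%N]mulnC exprM (prim_expr_order wP) expr1n.
    by rewrite subnn subn0 expr0; congr (_ *: _); exact/esym/TY.
  by rewrite big_ord_recr [RHS]big_ord_recl /= VE addrC.
have Sz j x : (0 < j < n.+2)%N -> S j x = 0.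
  case/andP=> j0 jn; apply: (intertwine_eq0 hH (w := w ^- j) YY Yinj e0 Ye) => //.
    rewrite normfV normrX; have /eqP -> : `|w| == 1.
      rewrite -(@pexpr_eq1 _ _ n.+2)// -normrX (prim_expr_order wP) normr1//.
    by rewrite expr1n invr1.
  rewrite invr_eq1 -(prim_order_dvd wP) gtnNdvd//.
have USame i x : (i < n.+2)%N -> n.+2%:R *: U i x = S 0%N x.
  move=> lti; transitivity (\sum_(j < n.+2) w ^- (j * i) *: S j x).
    under eq_bigr => j _ do rewrite /S scaler_sumr.
    rewrite exchange_big /= (bigD1 (Ordinal lti))//= [X in _ + X]big1 => [|k ki].
      rewrite addr0; under eq_bigr => j _ do rewrite scalerA mulrC.
      by rewrite -scaler_suml (prim_root_sum wP)// eqxx.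
    under eq_bigr => j _ do rewrite scalerA mulrC.
    rewrite -scaler_suml (prim_root_sum wP)//.
    by rewrite -(inj_eq val_inj) /= in ki; rewrite (negbTE ki) scale0r.
  rewrite big_ord_recl mul0n expr0 invr1 scale1r big1 ?addr0// => j _.
  by rewrite Sz ?scaler0//; exact: (ltn_ord (lift ord0 j)).
(* The two last indices give [Y^(m-1) T = Y^(m-2) T Y], where the injective [Y^(m-2)] cancels. *)
have Uinj x : U n.+1 x = U n x.
  have n0 : n.+2%:R != 0 :> R[i] by rewrite pnatr_eq0.
  by apply: (scalerI n0); rewrite !USame.
have Ynsub k : injective (iter k Y).
  by elim: k => // k IHk x y /(adjoint_pair_injective YY Yinj)/IHk.
move=> x; have := Uinj x.
by rewrite /U subnn subSnn iterSr /= => /Ynsub.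
Qed.

(** Expand [0 <= '[y - t *: f (g y)]] with [t = (1 + M)^-1]: the quadratic term is at most [t *
    '[g y]], which leaves [t * '[g y] <= '[y]]. *)
Lemma op_bounded_adjoint (f g : H -> H) :
  adjoint_pair f g -> op_bounded f -> op_bounded g.
Proof.
move=> fg /(op_bounded_ip hH)[M M0 fM].
have M1 : 0 < 1 + M by rewrite ltr_pwDl.
have g2 y : '[g y] <= (1 + M) * '[y].
  pose t := (1 + M)^-1.
  have t0 : 0 < t by rewrite invr_gt0.
  have tR : t^* = t by apply/CrealP; rewrite ger0_real ?ltW.
  have gR : '[y, f (g y)] = '[g y] by rewrite ipC fg -ipC.
  have := dnorm_ge0 ip (y - t *: f (g y)).
  rewrite dnormB /= dnormZ ipZr tR gR rmorphM /= tR (CrealP (ger0_real (dnorm_ge0 _ _))).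
  rewrite (ger0_norm (ltW t0)) => le1.
  rewrite -ler_pdivrMl// -/t.
  have le3 : t ^+ 2 * '[f (g y)] <= t * '[g y].
    apply: le_trans (ler_wpM2l (exprn_ge0 _ (ltW t0)) (fM _)) _.
    rewrite expr2 -mulrA ler_wpM2l ?(ltW t0)// mulrA ler_piMl ?dnorm_ge0//.
    by rewrite ler_pdivrMl// mulr1 lerDr.
  rewrite -subr_ge0; apply: le_trans le1 _.
  rewrite -addrA lerD2l -subr_ge0.
  have -> : - (t * '[g y]) - (t ^+ 2 * '[f (g y)] - (t * '[g y] + t * '[g y]))
     = t * '[g y] - t ^+ 2 * '[f (g y)] by ring.
  by rewrite subr_ge0.
exists (1 + M) => [|y]; first exact: ltW.
rewrite -(@ler_pXn2r _ 2)// ?nnegrE ?mulr_ge0 ?(ltW M1)//.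
rewrite exprMn -!hH; apply: le_trans (g2 y) _.
rewrite ler_wpM2r ?dnorm_ge0// expr2 ler_peMr ?(ltW M1)//.
by rewrite lerDl.
Qed.

Lemma coprime_powers_normal (B B' : H -> H) (p q : nat) :
    adjoint_pair B B' -> op_bounded B -> (forall x, B x = 0 -> x = 0) ->
    (0 < p)%N -> coprime p q ->
    fun_comm (iter p B) (iter p B') -> fun_comm (iter q B) (iter q B') ->
  fun_comm B B'.
Proof.
move=> BB' Bb Binj p0 pq cp cq.
(* Bezout with natural coefficients: [u * p = v * q + 1]. *)
have [u v uv _] := egcdnP q p0; rewrite (eqP pq) addn1 in uv.
set b := (v * q)%N in uv; set a := (u * p)%N in uv.
have ca : fun_comm (iter a B) (iter a B').
  by move=> x; rewrite /a -!iter_mul; exact: fun_comm_iter2.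
have cb : fun_comm (iter b B) (iter b B').
  by move=> x; rewrite /b -!iter_mul; exact: fun_comm_iter2.
pose N := iter b B; pose N' := iter b B'.
have NN' : adjoint_pair N N' := adjoint_pair_iter b BB'.
have B'B := adjoint_pairC BB'.
have B'b := op_bounded_adjoint BB' Bb.
pose X := iter a B' \o iter a B; pose Y := N' \o N.
have YY : adjoint_pair Y Y.
  exact: adjoint_pair_comp (adjoint_pairC NN') NN'.
have Ninj x : N x = 0 -> x = 0.
  by rewrite /N; elim: (b) x => //= k IHk x /Binj; exact: IHk.
have YE x : '[Y x, x] = '[N x].
  by rewrite /= ipC -NN' -ipC.
have Yinj x : Y x = 0 -> x = 0.
  move=> Yx; apply: Ninj; apply/eqP; rewrite -(dnorm_eq0 ip) -YE Yx.
  by rewrite linear0l.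
have [M M0 N'M] := op_bounded_ip hH (op_bounded_iter b B'b).
have M1 : 0 < 1 + M by rewrite ltr_pwDl.
have M1i : 0 < (1 + M)^-1 by rewrite invr_gt0.
(* As [Y = N' N], ['[Y x] <= M * '[N x] = M * '[Y x, x]]; the added 1 keeps the constant
   invertible. *)
have Ye x : (1 + M)^-1 * '[Y x] <= '[Y x, x].
  rewrite ler_pdivrMl// YE; apply: le_trans (N'M _) _.
  by rewrite ler_wpM2r ?dnorm_ge0// lerDr.
have Nsub : injective N := adjoint_pair_injective NN' Ninj.
(* Both sides collapse to [B'^(a b) B^(a b)], since [B^a] and [B^b] commute with their adjoints. *)
have PE x : iter a Y x = iter b X x.
  by rewrite !iter_comm_comp// !iter_mul mulnC.
have BaE x : iter a B x = N (B x) by rewrite uv iterSr.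
have BP : fun_comm B (iter a Y).
  move=> x; apply: Nsub; rewrite -BaE.
  have -> : N (iter a Y (B x)) = iter a Y (N (B x)).
    by apply: fun_comm_iter => y; exact: cb.
  rewrite -BaE !PE; apply: fun_comm_iter => y; exact: ca.
have a0 : (0 < a)%N by rewrite uv.
have BY : fun_comm B Y.
  apply: (commute_root YY Yinj _ M1i Ye _ Bb a0) => //.
    by apply: op_bounded_comp; exact: op_bounded_iter.
  exact: adjoint_pair_linear BB'.
(* Take adjoints in [B Y = Y B], with [Y] self-adjoint. *)
have B'Y : fun_comm B' Y.
  by move=> x; apply: (ip_injl (ip := ip)) => z; rewrite B'B !YY -BY B'B.
have YN : injective Y := adjoint_pair_injective YY Yinj.
have B'aE x : iter a B' x = N' (B' x) by rewrite uv iterSr.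
have YBB' x : Y (B (B' x)) = iter a B (iter a B' x).
  by rewrite -BY /Y /= -[N' (N _)]cb -iterS -uv -/N' -B'aE.
have YB'B x : Y (B' (B x)) = iter a B' (iter a B x).
  by rewrite -B'Y /Y /= -BaE /N' -iterS -uv.
by move=> x; apply: YN; rewrite YBB' YB'B ca.
Qed.

End Roots.

(** * Unbounded operators as inverses of bounded ones *)

Section InverseOperators.
Context {R : realType} {H : completeNormedModType R[i]}.
Context {ip : {dot H for @Num.conj R[i]}} (hH : induces_norm ip).
Local Notation "''[' u , v ]" := (ip u v).
Local Notation "''[' u ]" := (ip u u).
Local Notation adjoint_pair := (@adjoint_pair R H ip).
Implicit Types (T A : partial_op H) (C B : H -> H).

(** [T] is the inverse of [C] on the range of [C]; this turns domain conditions into equations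
    between everywhere defined maps. *)
Definition inverse_op T C :=
  (forall x, dom T x <-> exists y, x = C y) /\ forall y, T (C y) = y.

Lemma inverse_op_pow A B n : inverse_op A B -> inverse_op (op_pow A n) (iter n B).
Proof.
move=> [domA AB]; elim: n => [|n [domAn AnB]].
  by split=> // x; split=> // _; exists x.
split=> [x|y]; last by rewrite iterSr /= AnB AB.
split=> [[/domAn[y ->]] | [z ->]].
  by rewrite AnB => /domA[z ->]; exists z; rewrite iterSr.
rewrite iterSr; split; first by apply/domAn; exists (B z).
by rewrite -/(op_pow A n) AnB; apply/domA; exists z.
Qed.

Lemma bounded_adjoint (B : {linear H -> H}) :
  op_bounded B -> exists B', adjoint_pair B B'.
Proof.
move=> [M M0 BM].
suff /choice[B' BB'] : forall y, exists z, forall x, '[B x, y] = '[x, z].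
  by exists B' => x y.
move=> y; have n0 : 0 <= 1 + '[y] by rewrite addr_ge0 ?dnorm_ge0.
(* The square root comes from [ip_bound], which controls the square of the functional by ['[B x] *
   (1 + '[y])]. *)
apply: (riesz hH (M := M * sqrtC (1 + '[y]))) => [a x z|x].
  by rewrite linearP linearDl /= ipZl.
rewrite -(@ler_pXn2r _ 2)// ?nnegrE ?mulr_ge0 ?sqrtC_ge0//.
apply: le_trans (ip_bound _ _) _; rewrite hH -mulrA [sqrtC _ * _]mulrC.
rewrite mulrA [leRHS]exprMn sqrtCK ler_wpM2r//.
by rewrite ler_pXn2r ?nnegrE ?mulr_ge0.
Qed.

(** Testing on the vectors [C u], which exhaust [dom T], turns the adjoint relation into [y = C' z];
    injectivity of [C'] makes the [z] picked by [xget] unique. *)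
Lemma adjoint_inverse T C C' :
    inverse_op T C -> adjoint_pair C C' -> injective C' ->
  inverse_op (adjoint ip T) C'.
Proof.
move=> [domT TC] CC' C'inj.
have relE y z : adjoint_rel ip T y z <-> y = C' z.
  split=> [yz|-> _ /domT[u ->]]; last by rewrite TC CC'.
  apply: (ip_injr (ip := ip)) => u; rewrite -CC' -yz ?TC//.
  by apply/domT; exists u.
split=> [x|y]; first by split=> -[z xz]; exists z; exact/relE.
rewrite /adjoint /=; apply: xget_unique; first exact/relE.
by move=> z /relE /C'inj.
Qed.

Lemma dense_ortho0 (V : set H) z : dense V ->
  (forall v, V v -> '[v, z] = 0) -> z = 0.
Proof.
move=> Vd Vz; apply/eqP; rewrite -(dnorm_eq0 ip) -normr_le0.
apply/ler_addgt0Pr => e e0; rewrite add0r.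
have d0 : 0 < e / (1 + '[z]) by rewrite divr_gt0// ltr_pwDl// dnorm_ge0.
have [||v [zv Vv]] := Vd (ball_ Num.norm z (e / (1 + '[z]))) _ _.
- by exists z; rewrite /= subrr normr0.
- by rewrite ball_normE; exact: ball_open.
rewrite /= in zv.
have -> : '[z] = '[z - v, z] by rewrite linearBl /= (Vz _ Vv) subr0.
by apply: (ip_small hH (ltW e0)); exact: ltW zv.
Qed.

Lemma normal_inverse_comm T C C' :
    inverse_op T C -> adjoint_pair C C' -> normal_op ip T -> fun_comm C C'.
Proof.
move=> TC CC' [Td _ [TT' _]] w.
(* The kernel of [C'] is orthogonal to the range of [C], which is the dense domain of [T]. *)
have C'inj : injective C'.
  apply: (adjoint_pair_injective (adjoint_pairC CC')) => z C'z.
  apply: (dense_ortho0 Td) => _ /(proj1 TC)[y ->].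
  by rewrite CC' C'z linear0r.
have := adjoint_inverse TC CC' C'inj.
move: (adjoint ip T) TT' => T' TT' [domT' T'C]; have [domT TCK] := TC.
(* At [C' (C w)] the product [T T'] is defined with value [w]; that [T' T] agrees there forces this
   point to be [C (C' w)]. *)
have [] := TT' (C' (C w)).
  by split; [apply/domT'; exists (C w) | rewrite T'C; apply/domT; exists w].
move=> [/domT[w1 wE] /domT'[w2]]; rewrite /= T'C wE !TCK => ->.
by rewrite T'C => ->.
Qed.

Lemma comm_inverse_normal T C C' :
    inverse_op T C -> adjoint_pair C C' -> op_bounded C ->
    injective C -> fun_comm C C' ->
  normal_op ip T.
Proof.
move=> TC CC' [M M0 CM] Cinj comm; have [domT TCK] := TC.
have C0 := adjoint_pair0 CC'.
have C'C := adjoint_pairC CC'.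
(* Commutation gives ['[C w] = '[w, C' (C w)] = '[w, C (C' w)]]. *)
have C'inj0 w : C' w = 0 -> w = 0.
  move=> C'w; apply: Cinj; rewrite C0; apply/eqP; rewrite -(dnorm_eq0 ip).
  by rewrite CC' -comm C'w C0 linear0r.
have C'inj := adjoint_pair_injective C'C C'inj0.
have T'C := adjoint_inverse TC CC' C'inj.
split.
- apply: (ortho_dense hH) => [|a _ _ /domT[u ->] /domT[v ->]|w wT].
  + by apply/domT; exists 0.
  + by apply/domT; exists (a *: u + v); rewrite (adjoint_pair_linear CC').
  + apply: C'inj0; apply: (ip_injl (ip := ip)) => z.
    by rewrite linear0l C'C wT//; apply/domT; exists z.
(* The graph of [T] is the transposed graph of the bounded [C]. The radius [e / (1 + M)] splits [e]
   between the first coordinate and the image under [C] of the second. *)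
- move=> u uT; suff uE : u.1 = C u.2.
    by split; [apply/domT; exists u.2 | rewrite uE TCK].
  apply/subr0_eq/eqP; rewrite -normr_le0; apply/ler_addgt0Pr => e e0.
  rewrite add0r; have M1 : 0 < 1 + M by rewrite ltr_pwDl.
  have d0 : 0 < e / (1 + M) by rewrite divr_gt0.
  have [v [[/domT[y v1] v2] [b1 b2]]] := uT _ (nbhsx_ballx u _ d0).
  rewrite v1 TCK in v2; rewrite -!ball_normE /= in b1 b2.
  have -> : u.1 - C u.2 = (u.1 - v.1) - C (u.2 - v.2).
    by rewrite (adjoint_pairB _ _ CC') v1 v2 opprB addrA subrK.
  apply: le_trans (ler_normB _ _) _.
  have -> : e = e / (1 + M) + M * (e / (1 + M)).
    by rewrite -[X in X + _]mul1r -mulrDl mulrC divfK ?gt_eqF.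
  apply: lerD; first exact: ltW.
  by apply: le_trans (CM _) _; rewrite ler_wpM2l// ltW.
- move: (adjoint ip T) T'C => T' [domT' T'C]; split=> x [].
  + move=> /domT'[z ->] /=; rewrite T'C => /domT[y ->].
    rewrite TCK -comm; split; last by rewrite TCK T'C.
    split; first by apply/domT; exists (C' y).
    by rewrite TCK; apply/domT'; exists y.
  + move=> /domT[z ->] /=; rewrite TCK => /domT'[y ->].
    rewrite T'C comm; split; last by rewrite T'C TCK.
    split; first by apply/domT'; exists (C y).
    by rewrite T'C; apply/domT; exists y.
Qed.

End InverseOperators.

Theorem theorem2p21 (R : realType) (H : completeNormedModType R[i])
    (ip : {dot H for @Num.conj R[i]}) (hH : induces_norm ip)
    (A : partial_op H) (A_lin : linear_op A) (A_inv : boundedly_invertible A)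
    (p q : nat) (p_gt0 : (0 < p)%N) (q_gt0 : (0 < q)%N) (pq : coprime p q)
    (Ap_normal : normal_op ip (op_pow A p))
    (Aq_normal : normal_op ip (op_pow A q)) :
  normal_op ip A.
Proof.
have [B [[M BM] [_ AB] BA]] := A_inv.
have Ainv : inverse_op A B.
  split=> [x|y]; last by have [] := AB y I.
  split=> [Ax|[y ->]]; last by have [[]] := AB y I.
  by exists (A x); have [] := BA x (conj Ax I).
have Bb : op_bounded B.
  (* [bounded_linear] leaves the sign of its constant open, whereas [op_bounded] wants it
     nonnegative. *)
  exists `|M| => // x; have Mx := le_trans (normr_ge0 _) (BM x).
  by apply: le_trans (BM x) _; rewrite -(ger0_norm Mx) normrM normr_id.
have Binj : injective B.
  by move=> x y xy; rewrite -(proj2 Ainv x) xy (proj2 Ainv).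
have [B' BB'] := bounded_adjoint hH Bb.
have comm n : normal_op ip (op_pow A n) -> fun_comm (iter n B) (iter n B').
  apply: (normal_inverse_comm hH); first exact: inverse_op_pow.
  exact: adjoint_pair_iter.
apply: (comm_inverse_normal hH Ainv BB' Bb Binj).
apply: (coprime_powers_normal hH BB' Bb _ p_gt0 pq) => [x Bx||]; try exact: comm.
by apply: Binj; rewrite Bx linear0.
Qed.
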